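(* The structure $(\mathcal{S}(\mathbb{N}^{\Sigma^*}),+,-,0,\mathbin{\&},\delta_{\emptyset})$ of finite signed measures on $\mathbb{N}^{\Sigma^*}$, with pointwise vector space operations, multiplication $\mathbin{\&}$, and multiplicative unit $\delta_\emptyset$ (the Dirac measure on the empty multiset), is an $\mathbb{R}$-algebra, i.e. a unital commutative associative algebra over $\mathbb{R}$.
   Context: $\Sigma$ is a finite alphabet and $\Sigma^*$ the set of finite strings over it. $\mathbb{N}^{\Sigma^*}$ is the set of all functions $\Sigma^*\to\mathbb{N}$ (multisets of strings with finite multiplicities), with multiset union $\uplus$ being pointwise addition. It carries the $\sigma$-algebra generated by the sets $[\alpha]_A=\{\beta\in\mathbb{N}^{\Sigma^*} : \beta(x)=\alpha(x)\text{ for all }x\in A\}$, where $\alpha\in\mathbb{N}^{\Sigma^*}$ and $A\subseteq\Sigma^*$ is finite and closed under prefixes. $\mathcal{S}(\mathbb{N}^{\Sigma^*})$ is the space of finite signed measures on this measurable space. For $\mu,\nu\in\mathcal{S}(\mathbb{N}^{\Sigma^*})$, $\mu\mathbin{\&}\nu=(\mu\otimes\nu)\circ\uplus^{-1}$ is the pushforward of the product measure $\mu\otimes\nu$ under $\uplus:\mathbb{N}^{\Sigma^*}\times\mathbb{N}^{\Sigma^*}\to\mathbb{N}^{\Sigma^*}$. The empty multiset is the constant $0$ function. *)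

(* Defs.v *)
From HB Require Import structures.
From mathcomp Require Import all_boot all_order all_algebra.
From mathcomp Require Import all_classical all_reals all_analysis.
From mathcomp Require Import ring.

Set Implicit Arguments.
Unset Strict Implicit.
Unset Printing Implicit Defensive.

Import Order.TTheory GRing.Theory Num.Theory.

Local Open Scope classical_set_scope.
Local Open Scope ring_scope.

Section multisets.
Variable Sigma : finType.

Definition prefix_closed (A : set (seq Sigma)) : Prop :=
  forall x y, prefix x y -> A y -> A x.

Definition cylinder (alpha : seq Sigma -> nat) (A : set (seq Sigma)) :
    set (seq Sigma -> nat) :=
  [set beta | forall x, A x -> beta x = alpha x].

Definition cylinders : set (set (seq Sigma -> nat)) :=
  [set B | exists alpha A,
     [/\ finite_set A, prefix_closed A & B = cylinder alpha A]].

Definition multiset := g_sigma_algebraType cylinders.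

Definition mempty : multiset := fun=> 0%N.

Definition muplus (p : multiset * multiset) : multiset :=
  fun x => (p.1 x + p.2 x)%N.

Lemma measurable_cylinder alpha A : finite_set A -> prefix_closed A ->
  measurable (cylinder alpha A : set multiset).
Proof. by move=> fA pA; apply: sub_sigma_algebra; exists alpha, A. Qed.

Lemma measurable_mult (x : seq Sigma) (k : nat) :
  measurable [set beta : multiset | beta x = k].
Proof.
pose A : set (seq Sigma) := [set y | prefix y x].
have fA : finite_set A.
  apply: (@sub_finite_set _ _ [set` [seq take i x | i <- iota 0 (size x).+1]]).
    move=> y yx; suff: y \in [seq take i x | i <- iota 0 (size x).+1] by [].
    apply/mapP; exists (size y); last by move: yx; rewrite /A/= prefixE => /eqP.
    by rewrite mem_iota/= add0n ltnS size_prefix.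
  exact: finite_seq.
have pA : prefix_closed A by move=> y z yz zx; exact: prefix_trans yz zx.
pose alpha (s : seq nat) : seq Sigma -> nat := fun y => nth 0%N s (size y).
pose F n : set multiset := if unpickle n is Some s then
  if nth 0%N s (size x) == k then cylinder (alpha s) A else set0 else set0.
rewrite (_ : [set beta | _] = \bigcup_n F n).
  apply: bigcupT_measurable => n; rewrite /F.
  case: unpickle => [s|]; last exact: measurable0.
  by case: ifP => _; [exact: measurable_cylinder|exact: measurable0].
apply/seteqP; split => beta /=.
- move=> bx; pose s := [seq beta (take i x) | i <- iota 0 (size x).+1].
  have sE i : (i <= size x)%N -> nth 0%N s i = beta (take i x).
    move=> ix; rewrite (nth_map 0%N) ?size_iota//.
    by rewrite nth_iota ?add0n.
  exists (pickle s) => //; rewrite /F pickleK sE// take_size bx eqxx.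
  move=> y yx; rewrite /alpha sE ?size_prefix//.
  by congr beta; move: yx; rewrite /A/= prefixE => /eqP.
- move=> [n _]; rewrite /F; case: unpickle => [s|//].
  by case: ifP => // /eqP <- bA; exact: bA (prefix_refl x).
Qed.

Lemma measurable_muplus : measurable_fun setT muplus.
Proof.
apply: measurability => //.
move=> _ [_ [alpha [A [fA _ ->]]] <-]; rewrite setTI.
rewrite (_ : _ @^-1` _ = \bigcap_(x in A) \bigcup_i \bigcup_j
    (if (i + j == alpha x)%N then
      [set b : multiset | b x = i] `*` [set b : multiset | b x = j]
     else set0)).
  apply: fin_bigcap_measurable => // x Ax.
  apply: bigcupT_measurable => i; apply: bigcupT_measurable => j.
  case: ifP => _; last exact: measurable0.
  by apply: measurableX; exact: measurable_mult.
apply/seteqP; split => -[b c] /=.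
- move=> bc x Ax; exists (b x) => //; exists (c x) => //.
  by rewrite -(bc x Ax) eqxx.
- move=> bc x /bc[i _ [j _]]; case: ifP => // /eqP <- /= [<- <-].
  by [].
Qed.

End multisets.

(* A charge of the library is a function on all sets whose values outside the *)
(* sigma-algebra are unconstrained. These values are set to 0 here, so that   *)
(* Leibniz equality of signed measures is equality on the measurable sets.    *)
Section signed_measure.
Context d (T : measurableType d) (R : realType).

Record signed_measure := SignedMeasure {
  sm_charge :> {charge set T -> \bar R} ;
  sm_nonmeasurable : forall A, ~ measurable A -> sm_charge A = 0%E }.

Lemma crestr0_nonmeasurable (nu : {charge set T -> \bar R}) (A : set T) :
  ~ measurable A -> crestr0 nu (@measurableT _ T) A = 0%E.
Proof. by move=> mA; rewrite /crestr0 memNset. Qed.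

Definition sm_of_charge (nu : {charge set T -> \bar R}) : signed_measure :=
  @SignedMeasure (crestr0 nu (@measurableT _ T)) (crestr0_nonmeasurable nu).

Lemma sm_of_chargeE (nu : {charge set T -> \bar R}) (A : set T) :
  measurable A -> sm_of_charge nu A = nu A.
Proof. by move=> mA; rewrite /sm_of_charge/= /crestr0 mem_set// /crestr setIT. Qed.

Lemma signed_measureP (mu nu : signed_measure) :
  (forall A, measurable A -> mu A = nu A) -> mu = nu.
Proof.
case: mu nu => -[mu cmu] mu0 [[nu cnu] nu0] /= munu.
have E : mu = nu.
  apply/funext => A; have [mA|mA] := pselect (measurable A); first exact: munu.
  by rewrite [LHS]mu0// [RHS]nu0.
subst nu; have E : cmu = cnu.
  case: cmu cnu {mu0 nu0 munu} => -[a] [b] [c] [[a'] [b'] [c']].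
  by rewrite (Prop_irrelevance a a') (Prop_irrelevance b b')
    (Prop_irrelevance c c').
by subst cnu; rewrite (Prop_irrelevance mu0 nu0).
Qed.

Definition sm_zero : signed_measure := sm_of_charge czero.
Definition sm_opp (mu : signed_measure) := sm_of_charge (copp mu).
Definition sm_add (mu nu : signed_measure) := sm_of_charge (cadd mu nu).
Definition sm_scale (r : R) (mu : signed_measure) :=
  sm_of_charge (cscale r mu).
Definition sm_dirac (a : T) :=
  sm_of_charge (charge_of_finite_measure (\d_a : {finite_measure set T -> \bar R})).

End signed_measure.

Section pos_neg.
Context d (T : measurableType d) (R : realType) (mu : {charge set T -> \bar R}).

Let hahn : {PN | hahn_decomposition mu PN.1 PN.2}.
Proof. by apply/cid; have [P [N ?]] := Hahn_decomposition mu; exists (P, N). Qed.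

Definition pos_part : {finite_measure set T -> \bar R} :=
  jordan_pos (proj2_sig hahn).
Definition neg_part : {finite_measure set T -> \bar R} :=
  jordan_neg (proj2_sig hahn).

Lemma pos_neg_partE A : measurable A -> mu A = (pos_part A - neg_part A)%E.
Proof.
by move=> mA; rewrite (jordan_decomp (proj2_sig hahn))// /cadd/= cscaleN1.
Qed.

End pos_neg.

Section product.
Context d1 d2 (T1 : measurableType d1) (T2 : measurableType d2) (R : realType).

Section finite_product.
Variables (m1 : {finite_measure set T1 -> \bar R})
          (m2 : {finite_measure set T2 -> \bar R}).

Definition fprod : set (T1 * T2) -> \bar R := (m1 \x m2)%E.

HB.instance Definition _ := Measure.on fprod.

Let fprod_fin : fin_num_fun fprod.
Proof.
apply: lty_fin_num_fun.
have := product_measure1E m1 m2 (@measurableT _ T1) (@measurableT _ T2).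
rewrite setXTT => fprodT; rewrite [ltLHS]fprodT.
by rewrite lte_mul_pinfty// ?ltey_eq fin_num_measure.
Qed.

HB.instance Definition _ := @Measure_isFinite.Build _ _ _ fprod fprod_fin.

End finite_product.

(* The library has no product of charges: the product measure is extended     *)
(* by bilinearity along the Jordan decompositions. By cprodE, its value on a  *)
(* measurable rectangle is the product of the values.                         *)
Definition cprod (mu : {charge set T1 -> \bar R})
    (nu : {charge set T2 -> \bar R}) : {charge set (T1 * T2)%type -> \bar R} :=
  cadd (cadd (charge_of_finite_measure (fprod (pos_part mu) (pos_part nu)))
             (charge_of_finite_measure (fprod (neg_part mu) (neg_part nu))))
       (copp
         (cadd (charge_of_finite_measure (fprod (pos_part mu) (neg_part nu)))
               (charge_of_finite_measure (fprod (neg_part mu) (pos_part nu))))).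

Lemma cprodE (mu : {charge set T1 -> \bar R}) (nu : {charge set T2 -> \bar R})
    (A : set T1) (B : set T2) :
  measurable A -> measurable B -> cprod mu nu (A `*` B) = (mu A * nu B)%E.
Proof.
move=> mA mB.
have pE (m1 : {finite_measure set T1 -> \bar R})
    (m2 : {finite_measure set T2 -> \bar R}) :
  charge_of_finite_measure (fprod m1 m2) (A `*` B) = (m1 A * m2 B)%E.
  exact: product_measure1E.
transitivity (
  (pos_part mu A * pos_part nu B + neg_part mu A * neg_part nu B)
  - (pos_part mu A * neg_part nu B + neg_part mu A * pos_part nu B))%E.
  by rewrite -!pE.
rewrite (pos_neg_partE mu mA) (pos_neg_partE nu mB).
rewrite -(@fineK _ (pos_part mu A)) ?fin_num_measure//.
rewrite -(@fineK _ (neg_part mu A)) ?fin_num_measure//.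
rewrite -(@fineK _ (pos_part nu B)) ?fin_num_measure//.
rewrite -(@fineK _ (neg_part nu B)) ?fin_num_measure//.
rewrite -!(EFinM, EFinD, EFinB, EFinN); congr EFin.
by ring.
Qed.

End product.

Section convolution.
Variables (R : realType) (Sigma : finType).

Definition muplus_pushforward
    (pi : {charge set (multiset Sigma * multiset Sigma)%type -> \bar R}) :
    {charge set (multiset Sigma) -> \bar R} :=
  measure_function_pushforward__canonical__charge_Charge pi
    (@measurable_muplus Sigma).

Lemma muplus_pushforwardE
    (pi : {charge set (multiset Sigma * multiset Sigma)%type -> \bar R}) :
  muplus_pushforward pi = pushforward pi (@muplus Sigma) :> (set _ -> _).
Proof. by []. Qed.

Definition sm_conv (mu nu : signed_measure (multiset Sigma) R) :
    signed_measure (multiset Sigma) R :=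
  sm_of_charge (muplus_pushforward (cprod mu nu)).

Definition sm_unit : signed_measure (multiset Sigma) R :=
  sm_dirac R (@mempty Sigma).

End convolution.

(* V carries a comAlgType structure whose operations are the given ones. An   *)
(* algebra of the library is nontrivial, so this includes one <> zero.        *)
Definition is_comAlgebra (K : pzRingType) (V : Type) (add : V -> V -> V)
    (opp : V -> V) (zero : V) (scale : K -> V -> V) (mul : V -> V -> V)
    (one : V) : Prop :=
  exists c : GRing.ComAlgebra.axioms_ K V,
    let A : comAlgType K := GRing.ComAlgebra.Pack c in
    [/\ (forall x y : A, x + y = add x y), (forall x : A, - x = opp x) &
        (0 : A) = zero] /\
    [/\ (forall (k : K) (x : A), k *: x = scale k x),
        (forall x y : A, x * y = mul x y) & (1 : A) = one].

(* Main.v *)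
(* By the pi-lambda theorem, a finite signed measure on a product is          *)
(* determined by its values on rectangles. Hence the product of charges is    *)
(* bilinear, commutative and associative up to the canonical bijections,      *)
(* compatible with pushforwards, and its product with [\d_a] is the image     *)
(* by [pair a]. Transporting these facts along the commutative monoid         *)
(* operation [muplus] gives the axioms of the convolution algebra.            *)
Require Import Defs.
From HB Require Import structures.
From mathcomp Require Import all_boot all_order all_algebra.
From mathcomp Require Import all_classical all_reals all_analysis.

Set Implicit Arguments.
Unset Strict Implicit.
Unset Printing Implicit Defensive.

Import GRing.Theory.

Local Open Scope classical_set_scope.
Local Open Scope ring_scope.

(** On a measurable rectangle [cprod] is the product of two finite numbers ([cprodE]), so there
    bilinearity, symmetry and associativity are laws of real multiplication. Uniqueness
    ([eq_charge_prod], [eq_charge_prod3]) spreads them to all measurable sets, which avoids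
    computing with Jordan decompositions, as these are not additive. Convolution is the image of
    [cprod] under [muplus]. By [cprod_cpush] an inner image can be pulled out of a product, so an
    iterated convolution is one image of a triple product, and the monoid laws of [muplus] conclude.
    The vector space laws hold set by set. *)

Section charge_uniqueness.
Context d (T : measurableType d) (R : realType).
Implicit Types mu nu : {charge set T -> \bar R}.

Lemma dynkin_eq_charge mu nu : mu setT = nu setT ->
  dynkin [set A | measurable A /\ mu A = nu A].
Proof.
move=> muT; split => [|A [mA muA]|F tF mF]; first by split.
  split; first exact: measurableC.
  by rewrite -setTD !chargeD// setTI muT muA.
have mFn n : measurable (F n) by have [] := mF n.
have mUF : measurable (\bigcup_n F n) by exact: bigcupT_measurable.
split=> //.
(* Both charges have the same partial sums along [F], so uniqueness of limits equates their values
   on the union. *)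
have := charge_semi_sigma_additive (s := mu) F mFn tF mUF.
under eq_cvg do under eq_bigr do rewrite (proj2 (mF _)).
by move=> /cvg_unique; apply => //; exact: charge_semi_sigma_additive.
Qed.

(** [G setT] provides the equal total masses needed for closure under complement. *)
Lemma eq_charge (G : set (set T)) mu nu :
  measurable = <<s G >> -> setI_closed G -> G setT ->
  (forall A, G A -> mu A = nu A) ->
  forall A, measurable A -> mu A = nu A.
Proof.
move=> mG GI GT munu A; rewrite mG -setI_closed_g_dynkin_g_sigma_algebra//.
suff /[apply] -[] : <<d G >> `<=` [set A | measurable A /\ mu A = nu A] by [].
apply: smallest_sub; first by apply: dynkin_eq_charge; exact: munu.
by move=> B GB; split; [rewrite mG; exact: sub_sigma_algebra|exact: munu].
Qed.

End charge_uniqueness.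

Section charge_pushforward.
Context d d' (T : measurableType d) (T' : measurableType d') (R : realType).

Definition cpush (f : T -> T') (mf : measurable_fun setT f)
    (mu : {charge set T -> \bar R}) : {charge set T' -> \bar R} :=
  measure_function_pushforward__canonical__charge_Charge mu mf.

(* An unrestricted [rewrite cpushE] also matches [mu A], read as the image of *)
(* [mu] by the identity: give the side ([LHS] or [RHS]) of the pushforward.   *)
Lemma cpushE (f : T -> T') (mf : measurable_fun setT f)
    (mu : {charge set T -> \bar R}) A : cpush mf mu A = mu (f @^-1` A).
Proof. by []. Qed.

End charge_pushforward.

(** * Uniqueness of charges on products *)

Lemma eq_charge_prod d1 d2 (T1 : measurableType d1) (T2 : measurableType d2)
    (R : realType) (pi rho : {charge set (T1 * T2)%type -> \bar R}) :
  (forall A B, measurable A -> measurable B -> pi (A `*` B) = rho (A `*` B)) ->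
  forall X, measurable X -> pi X = rho X.
Proof.
move=> pirho; apply: eq_charge; first exact: measurable_prod_measurableType.
- move=> _ _ [A mA [B mB <-]] [A' mA' [B' mB' <-]].
  exists (A `&` A'); first exact: measurableI.
  by exists (B `&` B'); [exact: measurableI|rewrite setXI].
- by exists setT => //; exists setT => //; rewrite setXTT.
- by move=> _ [A mA [B mB <-]]; exact: pirho.
Qed.

(* For fixed [A], [Y |-> pi (A `*` Y)] is again a charge: the second marginal *)
(* of the restriction of [pi] to [A `*` setT].                                *)
Lemma eq_charge_prod3 d1 d2 d3 (T1 : measurableType d1)
    (T2 : measurableType d2) (T3 : measurableType d3) (R : realType)
    (pi rho : {charge set (T1 * (T2 * T3))%type -> \bar R}) :
  (forall A B C, measurable A -> measurable B -> measurable C ->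
    pi (A `*` (B `*` C)) = rho (A `*` (B `*` C))) ->
  forall X, measurable X -> pi X = rho X.
Proof.
move=> pirho; apply: eq_charge_prod => A Y mA mY.
have mAT : measurable (A `*` [set: T2 * T3]) by exact: measurableX.
have sliceE (nu : {charge set (T1 * (T2 * T3))%type -> \bar R}) Z :
    cpush measurable_snd (crestr nu mAT) Z = nu (A `*` Z).
  rewrite cpushE/= /crestr; congr (nu _).
  by apply/seteqP; split => -[a z] /= => [[? []]|[]].
rewrite -!sliceE; apply: eq_charge_prod Y mY => B C mB mC.
by rewrite !sliceE; exact: pirho.
Qed.

(** * Algebraic laws of the product of charges *)

Section cprod_theory.
Context (R : realType).

(** [cprod] is built from chosen Hahn decompositions, so this independence is not visible from its
    definition. It allows replacing a signed measure by the raw charge it was made from. *)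
Lemma eq_cprod d1 d2 (T1 : measurableType d1) (T2 : measurableType d2)
    (mu mu' : {charge set T1 -> \bar R}) (nu nu' : {charge set T2 -> \bar R}) :
  (forall A, measurable A -> mu A = mu' A) ->
  (forall B, measurable B -> nu B = nu' B) ->
  forall X, measurable X -> cprod mu nu X = cprod mu' nu' X.
Proof.
move=> eqmu eqnu; apply: eq_charge_prod => A B mA mB.
by rewrite !cprodE// eqmu// eqnu.
Qed.

Lemma measurable_map_pair d1 d2 d1' d2' (T1 : measurableType d1)
    (T2 : measurableType d2) (T1' : measurableType d1')
    (T2' : measurableType d2') (f : T1 -> T1') (g : T2 -> T2') :
  measurable_fun setT f -> measurable_fun setT g ->
  measurable_fun setT (fun p : T1 * T2 => (f p.1, g p.2)).
Proof.
move=> mf mg; apply: measurable_fun_pair.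
  exact: measurableT_comp mf measurable_fst.
exact: measurableT_comp mg measurable_snd.
Qed.

Lemma cprod_cpush d1 d2 d1' d2' (T1 : measurableType d1)
    (T2 : measurableType d2) (T1' : measurableType d1')
    (T2' : measurableType d2') (f : T1 -> T1') (g : T2 -> T2')
    (mf : measurable_fun setT f) (mg : measurable_fun setT g)
    (mu : {charge set T1 -> \bar R}) (nu : {charge set T2 -> \bar R}) X :
  measurable X -> cprod (cpush mf mu) (cpush mg nu) X =
    cpush (measurable_map_pair mf mg) (cprod mu nu) X.
Proof.
apply: eq_charge_prod X => A B mA mB.
rewrite (cprodE _ _ mA mB).
have mfA : measurable (f @^-1` A).
  by rewrite -[X in measurable X]setTI; exact: mf.
have mgB : measurable (g @^-1` B).
  by rewrite -[X in measurable X]setTI; exact: mg.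
exact/esym/(cprodE mu nu mfA mgB).
Qed.

Lemma cprodC d1 d2 (T1 : measurableType d1) (T2 : measurableType d2)
    (mu : {charge set T1 -> \bar R}) (nu : {charge set T2 -> \bar R}) X :
  measurable X ->
    cprod nu mu X = cpush (@measurable_swap _ _ T1 T2) (cprod mu nu) X.
Proof.
apply: eq_charge_prod X => A B mA mB.
rewrite (cprodE _ _ mA mB) [RHS]cpushE.
rewrite (_ : _ @^-1` _ = B `*` A); first by rewrite (cprodE _ _ mB mA) muleC.
by apply/seteqP; split => -[b a] /= [].
Qed.

Lemma measurable_prodA d1 d2 d3 (T1 : measurableType d1)
    (T2 : measurableType d2) (T3 : measurableType d3) :
  measurable_fun setT (fun p : (T1 * T2) * T3 => (p.1.1, (p.1.2, p.2))).
Proof.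
apply: measurable_fun_pair.
  exact: measurableT_comp measurable_fst measurable_fst.
apply: measurable_fun_pair => //.
exact: measurableT_comp measurable_snd measurable_fst.
Qed.

Lemma cprodA d1 d2 d3 (T1 : measurableType d1)
    (T2 : measurableType d2) (T3 : measurableType d3)
    (mu : {charge set T1 -> \bar R}) (nu : {charge set T2 -> \bar R})
    (la : {charge set T3 -> \bar R}) X :
  measurable X -> cprod mu (cprod nu la) X =
    cpush (@measurable_prodA _ _ _ T1 T2 T3) (cprod (cprod mu nu) la) X.
Proof.
(* Rectangles with an arbitrary second side in [T2 * T3] would not do: their preimages under
   reassociation need not be rectangles. *)
apply: eq_charge_prod3 X => A B C mA mB mC.
rewrite [RHS]cpushE (_ : _ @^-1` _ = (A `*` B) `*` C); last first.
  by apply/seteqP; split => -[[a b] c] /= => [[? []]|[[]]].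
by rewrite !cprodE ?muleA//; exact: measurableX.
Qed.

Lemma cprodDl d1 d2 (T1 : measurableType d1) (T2 : measurableType d2)
    (mu mu' : {charge set T1 -> \bar R}) (nu : {charge set T2 -> \bar R}) X :
  measurable X ->
  cprod (cadd mu mu') nu X = cadd (cprod mu nu) (cprod mu' nu) X.
Proof.
apply: eq_charge_prod X => A B mA mB.
rewrite (cprodE _ _ mA mB).
transitivity ((mu A + mu' A) * nu B)%E => //.
(* Charges take finite values, so distributivity holds in the extended reals. *)
rewrite muleDl ?fin_num_adde_defl ?fin_num_measure//.
by rewrite -!(cprodE _ _ mA mB).
Qed.

Lemma cprodZl d1 d2 (T1 : measurableType d1) (T2 : measurableType d2) (r : R)
    (mu : {charge set T1 -> \bar R}) (nu : {charge set T2 -> \bar R}) X :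
  measurable X -> cprod (cscale r mu) nu X = cscale r (cprod mu nu) X.
Proof.
apply: eq_charge_prod X => A B mA mB.
rewrite (cprodE _ _ mA mB); transitivity (r%:E * mu A * nu B)%E => //.
by rewrite -muleA -(cprodE _ _ mA mB).
Qed.

Lemma cprod_dirac d1 d2 (T1 : measurableType d1) (T2 : measurableType d2)
    (a : T1) (nu : {charge set T2 -> \bar R}) X : measurable X ->
  cprod (charge_of_finite_measure (\d_a : {finite_measure set T1 -> \bar R}))
    nu X = cpush (@pair1_measurable _ _ T1 T2 a) nu X.
Proof.
apply: eq_charge_prod X => A B mA mB.
rewrite (cprodE _ _ mA mB) [RHS]cpushE /charge_of_finite_measure/= diracE.
have [/set_mem aA|/negP aA] := boolP (a \in A).
  by rewrite mul1e; congr (nu _); apply/seteqP; split => b //= [].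
rewrite mul0e (_ : _ @^-1` _ = set0) ?charge0//.
by rewrite -subset0 => b /= [/mem_set].
Qed.

End cprod_theory.

(** * The convolution algebra *)

Section signed_measure_algebra.
Variables (R : realType) (Sigma : finType).
Local Notation S := (signed_measure (multiset Sigma) R).
Implicit Types mu nu la : S.

Lemma sm_addE mu nu A : measurable A -> sm_add mu nu A = (mu A + nu A)%E.
Proof. by move=> mA; rewrite sm_of_chargeE. Qed.

Lemma sm_oppE mu A : measurable A -> sm_opp mu A = (- mu A)%E.
Proof. by move=> mA; rewrite sm_of_chargeE. Qed.

Lemma sm_zeroE A : measurable A -> (sm_zero _ _ : S) A = 0%E.
Proof. by move=> mA; rewrite sm_of_chargeE. Qed.

Lemma sm_scaleE r mu A : measurable A -> sm_scale r mu A = (r%:E * mu A)%E.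
Proof. by move=> mA; rewrite sm_of_chargeE. Qed.

Lemma sm_convE mu nu A : measurable A ->
  sm_conv mu nu A = cprod mu nu (@muplus Sigma @^-1` A).
Proof. by move=> mA; rewrite sm_of_chargeE. Qed.

Lemma measurable_muplus_preimage (A : set (multiset Sigma)) :
  measurable A -> measurable (@muplus Sigma @^-1` A).
Proof.
by move=> mA; rewrite -[X in measurable X]setTI; exact: measurable_muplus.
Qed.

Lemma sm_addA : associative (@sm_add _ (multiset Sigma) R).
Proof.
by move=> mu nu la; apply: signed_measureP => A mA; rewrite !sm_addE// addeA.
Qed.

Lemma sm_addC : commutative (@sm_add _ (multiset Sigma) R).
Proof.
by move=> mu nu; apply: signed_measureP => A mA; rewrite !sm_addE// addeC.
Qed.

Lemma sm_add0 : left_id (sm_zero _ _) (@sm_add _ (multiset Sigma) R).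
Proof.
by move=> mu; apply: signed_measureP => A mA;
  rewrite sm_addE// sm_zeroE// add0e.
Qed.

Lemma sm_addN :
  left_inverse (sm_zero _ _) (@sm_opp _ _ _) (@sm_add _ (multiset Sigma) R).
Proof.
move=> mu; apply: signed_measureP => A mA.
by rewrite sm_addE// sm_oppE// sm_zeroE// addeC subee// fin_num_measure.
Qed.

HB.instance Definition _ := gen_eqMixin S.
HB.instance Definition _ := gen_choiceMixin S.
HB.instance Definition _ := GRing.isZmodule.Build S
  sm_addA sm_addC sm_add0 sm_addN.

Lemma sm_scaleA a b mu : sm_scale a (sm_scale b mu) = sm_scale (a * b) mu.
Proof.
by apply: signed_measureP => A mA; rewrite !sm_scaleE// EFinM muleA.
Qed.

Lemma sm_scale1 : left_id 1 (@sm_scale _ (multiset Sigma) R).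
Proof.
by move=> mu; apply: signed_measureP => A mA; rewrite sm_scaleE// mul1e.
Qed.

Lemma sm_scaleDr : right_distributive (@sm_scale _ (multiset Sigma) R) +%R.
Proof.
move=> a mu nu; apply: signed_measureP => A mA.
rewrite [RHS]sm_addE// !sm_scaleE// sm_addE// muleDr//.
by rewrite fin_num_adde_defl// fin_num_measure.
Qed.

Lemma sm_scaleDl mu : {morph (@sm_scale _ _ R)^~ mu : a b / a + b}.
Proof.
move=> a b; apply: signed_measureP => A mA.
by rewrite [RHS]sm_addE// !sm_scaleE// EFinD muleDl// fin_num_measure.
Qed.

HB.instance Definition _ := GRing.Zmodule_isLmodule.Build R S
  sm_scaleA sm_scale1 sm_scaleDr sm_scaleDl.

Lemma sm_convC : commutative (@sm_conv R Sigma).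
Proof.
move=> mu nu; apply: signed_measureP => A mA; rewrite 2!(sm_convE _ _ mA).
rewrite cprodC; last exact: measurable_muplus_preimage.
rewrite [LHS]cpushE; congr (cprod nu mu _); apply/funext => -[b c] /=.
by congr A; apply/funext => x; rewrite /muplus/= addnC.
Qed.

(** Viewing an untouched factor as its own image under [id] makes [cprod_cpush] applicable when only
    the other factor is convolved. *)
Let measurable_idT : measurable_fun [set: multiset Sigma] id :=
  @measurable_id _ _ setT.

Let cpush_muplusE mu nu B : measurable B ->
  cpush (@measurable_muplus Sigma) (cprod mu nu) B = sm_conv mu nu B.
Proof. by move=> mB; rewrite sm_convE. Qed.

Let cpush_idE mu B : measurable B -> cpush measurable_idT mu B = mu B.
Proof. by []. Qed.

Lemma sm_conv_convr mu nu la A : measurable A ->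
  sm_conv mu (sm_conv nu la) A =
  cprod mu (cprod nu la) [set t | A (muplus (t.1, muplus t.2))].
Proof.
move=> mA; have mpA := measurable_muplus_preimage mA.
apply: (etrans (sm_convE _ _ mA)).
apply: (etrans (esym (eq_cprod (@cpush_idE mu) (@cpush_muplusE nu la) mpA))).
exact: (cprod_cpush measurable_idT (@measurable_muplus Sigma) _ _ mpA).
Qed.

Lemma sm_conv_convl mu nu la A : measurable A ->
  sm_conv (sm_conv mu nu) la A =
  cprod (cprod mu nu) la [set t | A (muplus (muplus t.1, t.2))].
Proof.
move=> mA; have mpA := measurable_muplus_preimage mA.
apply: (etrans (sm_convE _ _ mA)).
apply: (etrans (esym (eq_cprod (@cpush_muplusE mu nu) (@cpush_idE la) mpA))).
exact: (cprod_cpush (@measurable_muplus Sigma) measurable_idT _ _ mpA).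
Qed.

Lemma sm_convA : associative (@sm_conv R Sigma).
Proof.
move=> mu nu la; apply: signed_measureP => A mA.
rewrite (sm_conv_convr mu nu la mA) (sm_conv_convl mu nu la mA).
set X := [set t | _].
have mX : measurable X.
  have := measurable_map_pair measurable_idT (@measurable_muplus Sigma)
    measurableT (measurable_muplus_preimage mA).
  by rewrite setTI.
(* After reassociation both sides measure, with the same triple product, the set of triples whose
   sum lies in [A]. *)
apply: (etrans (cprodA _ _ _ mX)).
congr (cprod (cprod mu nu) la _); apply/funext => -[[b c] e].
by congr A; apply/funext => x; rewrite /muplus/= addnA.
Qed.

Lemma sm_conv1 : left_id (@sm_unit R Sigma) (@sm_conv R Sigma).
Proof.
move=> mu; apply: signed_measureP => A mA; rewrite sm_convE//.
have mpA := measurable_muplus_preimage mA.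
(* What remains holds by conversion: [muplus (mempty, b)] computes to [b]. *)
by rewrite (eq_cprod (sm_of_chargeE _) (fun _ _ => erefl))// cprod_dirac.
Qed.

Lemma sm_convDl : left_distributive (@sm_conv R Sigma) (@sm_add _ _ R).
Proof.
move=> mu nu la; apply: signed_measureP => A mA.
have mpA := measurable_muplus_preimage mA.
apply: (etrans (sm_convE _ _ mA)).
apply: (etrans (eq_cprod (mu' := cadd mu nu) (@sm_addE mu nu)
  (fun _ _ => erefl) mpA)).
apply: (etrans (cprodDl mu nu la mpA)).
by rewrite (sm_addE _ _ mA) 2!(sm_convE _ _ mA).
Qed.

(** Total mass separates the two: 1 against 0. *)
Lemma sm_unit_neq0 : sm_unit R Sigma != 0 :> S.
Proof.
apply/eqP => /(congr1 (fun mu : S => mu setT)); rewrite sm_zeroE//.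
rewrite sm_of_chargeE// /charge_of_finite_measure/= diracT.
by move=> /eqP; rewrite onee_eq0.
Qed.

HB.instance Definition _ := GRing.Zmodule_isComNzRing.Build S
  sm_convA sm_convC sm_conv1 sm_convDl sm_unit_neq0.

(** Together with commutativity this also gives compatibility of scaling with the right factor. *)
Lemma sm_convZl (r : R) mu nu :
  sm_scale r (sm_conv mu nu) = sm_conv (sm_scale r mu) nu.
Proof.
apply: signed_measureP => A mA; have mpA := measurable_muplus_preimage mA.
apply/esym/(etrans (sm_convE _ _ mA)).
apply: (etrans (eq_cprod (mu' := cscale r mu) (@sm_scaleE r mu)
  (fun _ _ => erefl) mpA)).
apply: (etrans (cprodZl r mu nu mpA)).
by rewrite (sm_scaleE _ _ mA) (sm_convE _ _ mA).
Qed.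

HB.instance Definition _ := GRing.Lmodule_isLalgebra.Build R S sm_convZl.
HB.instance Definition _ := GRing.Lalgebra_isComAlgebra.Build R S.

End signed_measure_algebra.

Theorem lemma2p1 (R : realType) (Sigma : finType) :
  is_comAlgebra
    (@sm_add _ (multiset Sigma) R) (@sm_opp _ (multiset Sigma) R)
    (@sm_zero _ (multiset Sigma) R) (@sm_scale _ (multiset Sigma) R)
    (@sm_conv R Sigma) (@sm_unit R Sigma).
Proof.
(* The instances were built from these very operations, so all six equalities hold by conversion. *)
by exists (GRing.ComAlgebra.class
  (signed_measure (multiset Sigma) R : comAlgType R)).
Qed.
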